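(* Let $(N,\nu)$ be a Cobb--Douglas production game, i.e. $\nu(S)=\max_{x\ge0}\{\prod_{j=1}^dx_j^{\lambda_j}:\mathcal{A}x=b(S)\}$ for $S\subseteq N$, where $b(S)=\sum_{i\in S}b(i)$. Consider for each $S$ the power cone program $$\nu(S)=\max\{t:\ \mathcal{A}x=b(S),\ (x,t)\in\mathcal{P}^d_\lambda\}.$$ If this conic program for the grand coalition $S=N$ verifies the Slater condition, then the core of $(N,\nu)$ is nonempty.
   Context: $N$ is a finite set of agents; $b:N\to\mathbb{R}^m$ assigns to each agent a bundle of $m$ resources; $\mathcal{A}:\mathbb{R}^d\to\mathbb{R}^m$ is linear; $\lambda_j\ge0$ with $\sum_{j=1}^d\lambda_j=1$. The power cone is $\mathcal{P}^d_\lambda=\{(x,t)\in\mathbb{R}^d_+\times\mathbb{R}:|t|\le\prod_{j=1}^dx_j^{\lambda_j}\}$. ''max'' denotes the optimal value; since $(N,\nu)$ is a TU game, $\nu$ is real-valued. The Slater condition for the program means that there is a feasible point in the interior of the cone: some $(x,t)$ in the interior of $\mathcal{P}^d_\lambda$ with $\mathcal{A}x=b(N)$. The core of a TU game $(N,\nu)$ is the set of $z\in\mathbb{R}^N$ with $\sum_{i\in N}z_i=\nu(N)$ and $\sum_{i\in S}z_i\ge\nu(S)$ for all coalitions $\emptyset\ne S\subset N$. *)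

(* Defs.v *)
From HB Require Import structures.
From mathcomp Require Import all_boot all_order all_algebra.
From mathcomp Require Import all_classical all_reals all_analysis.

Set Implicit Arguments.
Unset Strict Implicit.
Unset Printing Implicit Defensive.

Import Order.TTheory GRing.Theory Num.Theory.
Import numFieldNormedType.Exports.

Local Open Scope classical_set_scope.
Local Open Scope ring_scope.

Section TUGame.
Variables (R : realType) (N : finType).

(* The codomain is real, so [nu S] is finite for every coalition. *)
Definition core (nu : {set N} -> R) : set (N -> R) :=
  [set z | \sum_(i : N) z i = nu [set: N]%SET /\
           forall S : {set N}, S != finset.set0 -> nu S <= \sum_(i in S) z i].

Definition coalition_bundle (m : nat) (b : N -> 'cV[R]_m) (S : {set N}) :
    'cV[R]_m :=
  \sum_(i in S) b i.

End TUGame.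

Section Programs.
Variables (R : realType) (d m : nat).
Implicit Types (lam : 'I_d -> R) (A : {linear 'cV[R]_d -> 'cV[R]_m}).
Implicit Types (w : 'cV[R]_m) (x : 'cV[R]_d).

(* [powR] satisfies [0 `^ 0 = 1], so a coordinate with exponent 0 contributes
   the factor 1 even where it vanishes. *)
Definition cobb_douglas lam x : R := \prod_(j < d) (x j 0) `^ (lam j).

(* Optimal values are suprema in the extended reals: [-oo] if the program is
   infeasible, [+oo] if it is unbounded. *)
Definition cobb_douglas_value lam A w : \bar R :=
  ereal_sup [set (cobb_douglas lam x)%:E |
    x in [set x : 'cV[R]_d | (forall j, 0 <= x j 0) /\ A x = w]].

Definition power_cone lam : set ('cV[R]_d * R) :=
  [set p : 'cV[R]_d * R |
    (forall j, 0 <= p.1 j 0) /\ `|p.2| <= cobb_douglas lam p.1].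

Definition power_program_value lam A w : \bar R :=
  ereal_sup [set p.2%:E |
    p in [set p : 'cV[R]_d * R | A p.1 = w /\ power_cone lam p]].

Definition power_program_slater lam A w : Prop :=
  exists p : 'cV[R]_d * R, interior (power_cone lam) p /\ A p.1 = w.

Lemma power_program_valueE lam A w :
  power_program_value lam A w = cobb_douglas_value lam A w.
Proof.
apply/eqP; rewrite eq_le; apply/andP; split; apply: ge_ereal_sup.
  move=> _ /= [[x t] /= [Axw [x0 tx]] <-].
  apply: (@le_trans _ _ (cobb_douglas lam x)%:E).
    by rewrite lee_fin (le_trans (ler_norm t)).
  by apply: ereal_sup_ubound; exists x.
move=> _ /= [x [x0 Axw] <-].
apply: ereal_sup_ubound; exists (x, cobb_douglas lam x) => //=.
split=> //; split=> //=; rewrite ger0_norm //.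
by apply: prodr_ge0 => j _; exact: powR_ge0.
Qed.

End Programs.

Definition cobb_douglas_game (R : realType) (N : finType) (d m : nat)
    (lam : 'I_d -> R) (A : {linear 'cV[R]_d -> 'cV[R]_m}) (b : N -> 'cV[R]_m)
    (nu : {set N} -> R) : Prop :=
  forall S : {set N},
    (nu S)%:E = cobb_douglas_value lam A (coalition_bundle b S).

(* Main.v *)
Require Import Defs.
From HB Require Import structures.
From mathcomp Require Import all_boot all_order all_algebra.
From mathcomp Require Import all_classical all_reals all_analysis.
From mathcomp Require Import lra.

Set Implicit Arguments.
Unset Strict Implicit.
Unset Printing Implicit Defensive.

Import Order.TTheory GRing.Theory Num.Theory.
Import numFieldNormedType.Exports.

Local Open Scope classical_set_scope.
Local Open Scope ring_scope.

(** The Cobb-Douglas function F is positively homogeneous and superadditive on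
    the nonnegative orthant, so the optimal value of the production program is
    a superlinear function of the right-hand side.  A core allocation is a
    supergradient of that function at the grand bundle b(N): a system of prices
    under which every producible linear combination of the b(i) costs at least
    its value, while b(N) costs exactly nu(N).

    The supergradient comes from a finite-dimensional Hahn-Banach argument
    [cone_supporting_vector].  It is applied to the convex cone of the pairs
    (w, r) such that, for some t >= 0 and u >= 0,
      A u = w + t b(N)  and  r <= F u - t nu(N).
    That is, the hypograph of the value function is enlarged by the ray through
    (- b(N), - nu(N)), which forces the price of b(N) to be at most nu(N).
    Two facts have to be checked:
    - the cone contains a point above each b(i) and each - b(i): every coalition
      is feasible because nu is real-valued, and - b(i) is b(N \ {i}) - b(N);
    - the cone contains no (0, r) with r > 0: otherwise b(N) could be produced
      with arbitrarily large value, against the finiteness of nu(N).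
    Taking (b(S), F x) with A x = b(S) and (- b(N), - nu(N)) in the cone then
    gives the coalitional inequalities and efficiency.

    Superadditivity of F ([cobb_douglasD]) is deduced from the weighted
    inequality between the arithmetic and the geometric mean. *)

(** Hahn-Banach for finitely many vectors: the convex cone [H] lies below a
    linear functional on the span of the [e i].  The functional is given by its
    values [z i] on the [e i], which need not be independent; [He] and [HNe]
    say that the cone meets the vertical line over [e i] and over [- e i].  The
    values are chosen one index at a time. *)
Lemma cone_supporting_vector (R : realType) (V : lmodType R) (I : finType)
    (H : V -> R -> Prop)
    (HD : forall v w r s, H v r -> H w s -> H (v + w) (r + s))
    (HZ : forall c v r, 0 < c -> H v r -> H (c *: v) (c * r))
    (H0 : forall r, H 0 r -> r <= 0)
    (e : I -> V)
    (He : forall i, exists r, H (e i) r)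
    (HNe : forall i, exists r, H (- e i) r) :
  exists z : I -> R, forall (a : I -> R) r,
    H (\sum_i a i *: e i) r -> r <= \sum_i a i * z i.
Proof.
suff ext (s : seq I) : uniq s -> exists z : I -> R, forall (a : I -> R) r,
    H (\sum_(i <- s) a i *: e i) r -> r <= \sum_(i <- s) a i * z i.
  by have [z Hz] := ext _ (index_enum_uniq I); exists z.
elim: s => [|k s IHs] /=.
  by move=> _; exists (fun=> 0) => a r; rewrite !big_nil; exact: H0.
case/andP=> ks /IHs [z Hz].
(* The value at k must be at least every element of E, and at most every bound
   that the points of the cone over - e k impose. *)
pose E : set R := [set q | exists (a : I -> R) r,
  H (e k + \sum_(i <- s) a i *: e i) r /\ q = r - \sum_(i <- s) a i * z i].
have E_ub (a : I -> R) r : H (- e k + \sum_(i <- s) a i *: e i) r ->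
    ubound E (\sum_(i <- s) a i * z i - r).
  move=> Har _ [a' [r' [Har' ->]]].
  have := HD _ _ _ _ Har Har'.
  rewrite addrACA addNr add0r -big_split/=.
  under eq_bigr do rewrite -scalerDl.
  move=> /(Hz (fun i => a i + a' i)).
  under [X in _ <= X -> _]eq_bigr do rewrite mulrDl.
  rewrite big_split/=; lra.
have s0 : \sum_(i <- s) (0 : R) *: e i = 0.
  by rewrite big1 // => i _; rewrite scale0r.
have E_neq0 : E !=set0.
  have [r Hr] := He k; exists (r - \sum_(i <- s) 0 * z i).
  by exists (fun=> 0), r; rewrite s0 addr0.
have E_has_ub : has_ubound E.
  have [r Hr] := HNe k; exists (\sum_(i <- s) 0 * z i - r).
  by apply: (E_ub (fun=> 0)); rewrite s0 addr0.
exists (fun i => if i == k then sup E else z i) => a r.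
rewrite !big_cons eqxx.
under [X in _ <= _ + X]eq_big_seq => i si.
  rewrite ifN; last by apply: contraNneq ks => <-.
  over.
have scale_e c : c *: (\sum_(i <- s) a i *: e i) =
    \sum_(i <- s) (c * a i) *: e i.
  by rewrite scaler_sumr; apply: eq_bigr => i _; rewrite scalerA.
have scale_z c : \sum_(i <- s) c * a i * z i = c * \sum_(i <- s) a i * z i.
  by rewrite mulr_sumr; apply: eq_bigr => i _; rewrite mulrA.
(* Rescaling makes the coefficient of e k equal to 1 or -1. *)
case: (ltrgt0P (a k)) => [ak_gt0|ak_lt0|->]; last first.
- by rewrite scale0r mul0r !add0r; exact: Hz.
- have ak' : 0 < - (a k)^-1 by rewrite oppr_gt0 invr_lt0.
  move=> /(HZ _ _ _ ak').
  rewrite scalerDr scalerA mulNr mulVf ?lt_eqF// scaleN1r scale_e.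
  move=> /(E_ub (fun i => - (a k)^-1 * a i)) /(ge_sup E_neq0).
  rewrite scale_z -mulrBr mulNr -mulrN opprB mulrC ler_ndivlMr//.
  lra.
have ak' : 0 < (a k)^-1 by rewrite invr_gt0.
move=> /(HZ _ _ _ ak').
rewrite scalerDr scalerA mulVf ?gt_eqF// scale1r scale_e => Har.
have : (a k)^-1 * r - \sum_(i <- s) (a k)^-1 * a i * z i <= sup E.
  apply: ub_le_sup => //.
  by exists (fun i => (a k)^-1 * a i), ((a k)^-1 * r).
rewrite scale_z -mulrBr mulrC ler_pdivrMr//.
lra.
Qed.

Section CobbDouglas.
Variables (R : realType) (d : nat) (lam : 'I_d -> R).
Hypotheses (lam_ge0 : forall j, 0 <= lam j) (lam_sum1 : \sum_(j < d) lam j = 1).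
Implicit Types (x y : 'cV[R]_d) (a : 'I_d -> R).

Lemma cobb_douglas_ge0 x : 0 <= cobb_douglas lam x.
Proof. by apply: prodr_ge0 => j _; exact: powR_ge0. Qed.

(** The factor by which [cobb_douglas] grows when its argument is scaled by [c]. *)
Lemma prod_powR_weights c : 0 < c -> \prod_(j < d) c `^ lam j = c.
Proof.
move=> c0; rewrite -[RHS]powRr1 ?ltW// -lam_sum1.
elim/big_rec2 : _ => [|j p q _ ->]; first by rewrite powRr0.
by rewrite powRD // (gt_eqF c0) implybT.
Qed.

Lemma cobb_douglasZ c x : 0 < c -> (forall j, 0 <= x j 0) ->
  cobb_douglas lam (c *: x) = c * cobb_douglas lam x.
Proof.
move=> c0 x0; rewrite -{2}(prod_powR_weights c0) -big_split/=.
by apply: eq_bigr => j _; rewrite mxE powRM// ltW.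
Qed.

Lemma weighted_AGM a : (forall j, 0 <= a j) ->
  \prod_(j < d) a j `^ lam j <= \sum_(j < d) lam j * a j.
Proof.
move=> a0; set M := \sum_(j < d) _.
have la0 j : 0 <= lam j * a j by rewrite mulr_ge0.
have : 0 <= M by apply: sumr_ge0.
rewrite le_eqVlt => /predU1P[M0|M0].
  have [j lamj] : exists j, lam j != 0.
    apply/existsP; apply: contra_eqT lam_sum1.
    rewrite negb_exists => /forallP lam0.
    rewrite big1 1?eq_sym ?oner_eq0// => j _.
    by apply/eqP; rewrite -[_ == _]negbK.
  have aj0 : a j = 0.
    have /eqP := esym M0; rewrite psumr_eq0// => /allP /(_ j).
    by rewrite mem_index_enum mulf_eq0 (negbTE lamj) => /(_ isT)/eqP.
  by rewrite -M0 (bigD1 j)//= aj0 powR0// mul0r.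
(* Apply y <= exp (y - 1) to y = a j / M; the exponents add up to 0.  This form
   also covers a j = 0. *)
have step j : a j `^ lam j <= M `^ lam j * expR (lam j * (a j / M - 1)).
  rewrite [lam j * _]mulrC expRM -powRM ?expR_ge0 ?(ltW M0)//.
  apply: ge0_ler_powR; rewrite ?nnegrE ?mulr_ge0 ?expR_ge0 ?(ltW M0)//.
  rewrite mulrC -ler_pdivrMr//; apply: le_trans (expR_ge1Dx _).
  by rewrite addrC subrK.
apply: (@le_trans _ _ (\prod_(j < d)
    (M `^ lam j * expR (lam j * (a j / M - 1))))).
  by apply: ler_prod => j _; rewrite powR_ge0 step.
rewrite big_split/= prod_powR_weights// -expR_sum.
under eq_bigr do rewrite mulrBr mulr1 mulrA.
by rewrite big_split/= sumrN lam_sum1 -mulr_suml divff ?gt_eqF// subrr expR0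
  mulr1.
Qed.

(** Superadditivity: writing [w j = s j * (w j / s j)] with [s = x + y] for
    [w = x] and for [w = y], the arithmetic-geometric mean inequality bounds the
    two values by complementary shares of the value at [x + y].  Coordinates
    where [s j = 0] are harmless, since division by 0 gives 0. *)
Lemma cobb_douglasD x y : (forall j, 0 <= x j 0) -> (forall j, 0 <= y j 0) ->
  cobb_douglas lam x + cobb_douglas lam y <= cobb_douglas lam (x + y).
Proof.
move=> x0 y0.
pose s j := x j 0 + y j 0.
have s0 j : 0 <= s j by rewrite addr_ge0.
have share (w : 'cV[R]_d) :
    (forall j, 0 <= w j 0) -> (forall j, s j = 0 -> w j 0 = 0) ->
    cobb_douglas lam w <=
    cobb_douglas lam (x + y) * \sum_(j < d) lam j * (w j 0 / s j).
  move=> w0 ws.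
  have ws0 j : 0 <= w j 0 / s j by rewrite divr_ge0.
  rewrite (_ : cobb_douglas lam w =
      cobb_douglas lam (x + y) * \prod_(j < d) (w j 0 / s j) `^ lam j).
    by rewrite ler_wpM2l ?cobb_douglas_ge0// weighted_AGM.
  rewrite -big_split/=; apply: eq_bigr => j _.
  rewrite mxE -/(s j) -powRM//; congr (_ `^ _).
  have [sj|sj] := eqVneq (s j) 0; first by rewrite ws// sj mul0r.
  by rewrite mulrC divfK.
have le_shares j : x j 0 / s j + y j 0 / s j <= 1.
  rewrite -mulrDl -/(s j); have [->|sj] := eqVneq (s j) 0.
    by rewrite mul0r ler01.
  by rewrite divff.
have xs j : s j = 0 -> x j 0 = 0.
  by move=> /eqP; rewrite paddr_eq0// => /andP[/eqP].
have ys j : s j = 0 -> y j 0 = 0.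
  by move=> /eqP; rewrite paddr_eq0// => /andP[_ /eqP].
apply: le_trans (lerD (share _ x0 xs) (share _ y0 ys)) _.
rewrite -mulrDr -big_split/= -[leRHS]mulr1 ler_wpM2l ?cobb_douglas_ge0//.
rewrite -lam_sum1; apply: ler_sum => j _.
by rewrite -mulrDr -[leRHS]mulr1 ler_wpM2l.
Qed.

(** The supremum over an empty feasible set is [-oo], hence not real. *)
Lemma feasible_of_fin_value m (A : {linear 'cV[R]_d -> 'cV[R]_m}) w (r : R) :
  r%:E = cobb_douglas_value lam A w ->
  exists x, (forall j, 0 <= x j 0) /\ A x = w.
Proof.
move=> rE; apply: contrapT => nofeas.
suff noset : [set x : 'cV[R]_d | (forall j, 0 <= x j 0) /\ A x = w] = set0.
  by move: rE; rewrite /cobb_douglas_value noset image_set0 ereal_sup0.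
by apply/seteqP; split=> // x xfeas; apply: nofeas; exists x.
Qed.

End CobbDouglas.

Theorem corollary9 (R : realType) (N : finType) (d m : nat)
    (lam : 'I_d -> R) (lam_ge0 : forall j, 0 <= lam j)
    (lam_sum1 : \sum_(j < d) lam j = 1)
    (A : {linear 'cV[R]_d -> 'cV[R]_m}) (b : N -> 'cV[R]_m)
    (nu : {set N} -> R) (game : cobb_douglas_game lam A b nu)
    (slater : power_program_slater lam A
                (coalition_bundle b [set: N]%SET)) :
  core nu !=set0.
Proof.
pose F := cobb_douglas lam.
pose w0 := coalition_bundle b [set: N]%SET.
have sumT (V : zmodType) (f : N -> V) :
    \sum_(i in [set: N]%SET) f i = \sum_i f i.
  by apply: eq_bigl => i; rewrite inE.
pose nu0 := nu [set: N]%SET.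
have feasible S := feasible_of_fin_value (game S).
have F_le_nu (S : {set N}) (x : 'cV[R]_d) :
    (forall j, 0 <= x j 0) -> A x = coalition_bundle b S ->
    F x <= nu S.
  move=> x0 Ax; rewrite -lee_fin (game S).
  by apply: ereal_sup_ubound; exists x.
(* The hypograph of the value function enlarged by the ray (- b(N), - nu(N)). *)
pose H (w : 'cV[R]_m) (r : R) := exists (u : 'cV[R]_d) (t : R),
  [/\ forall j, 0 <= u j 0, 0 <= t, A u = w + t *: w0 & r <= F u - t * nu0].
have HD v w r s : H v r -> H w s -> H (v + w) (r + s).
  move=> [u [t [u0 t0 Au ru]]] [u' [t' [u'0 t'0 Au' su']]].
  exists (u + u'), (t + t'); split.
  - by move=> j; rewrite mxE addr_ge0.
  - exact: addr_ge0.
  - by rewrite linearD Au Au' scalerDl addrACA.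
  - have := cobb_douglasD lam_ge0 lam_sum1 u0 u'0.
    rewrite -/(F _) -/(F _) -/(F _); lra.
have HZ c v r : 0 < c -> H v r -> H (c *: v) (c * r).
  move=> c0 [u [t [u0 t0 Au ru]]]; exists (c *: u), (c * t); split.
  - by move=> j; rewrite mxE mulr_ge0// ltW.
  - by rewrite mulr_ge0// ltW.
  - by rewrite linearZ/= Au scalerDr scalerA.
  - by rewrite /F cobb_douglasZ// -mulrA -mulrBr ler_pM2l.
have [x0 [x0_ge0 Ax0]] := feasible [set: N]%SET.
have nu0_ge0 : 0 <= nu0.
  exact: le_trans (cobb_douglas_ge0 _ _) (F_le_nu _ _ x0_ge0 Ax0).
(* If (0, r) is in the cone with r > 0, then (x0 + k u) / (1 + k t) produces
   b(N); this k makes its value exceed nu(N). *)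
have H0 r : H 0 r -> r <= 0.
  move=> [u [t [u0 t0 Au ru]]]; rewrite leNgt; apply/negP => r_gt0.
  pose k := (nu0 + 1) / r.
  have k0 : 0 < k by rewrite divr_gt0// ltr_wpDl.
  have kt : 0 < 1 + k * t by rewrite ltr_pwDl// mulr_ge0// ltW.
  have ku0 j : 0 <= (k *: u) j 0 by rewrite mxE mulr_ge0// ltW.
  have xku0 j : 0 <= (x0 + k *: u) j 0 by rewrite mxE addr_ge0.
  have : F ((1 + k * t)^-1 *: (x0 + k *: u)) <= nu0.
    apply: F_le_nu => [j|].
      by rewrite mxE mulr_ge0// invr_ge0 ltW.
    rewrite linearZ/= linearD linearZ/= Ax0 Au add0r scalerA -/w0.
    rewrite -{1}[w0]scale1r.
    by rewrite -scalerDl scalerA mulVf ?scale1r ?gt_eqF.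
  rewrite /F cobb_douglasZ ?invr_gt0// mulrC ler_pdivrMr// => le_nu0.
  have := cobb_douglasD lam_ge0 lam_sum1 x0_ge0 ku0.
  rewrite cobb_douglasZ// => Fxku.
  have krE : k * r = nu0 + 1 by rewrite /k divfK// gt_eqF.
  have : k * r <= k * (F u - t * nu0) by rewrite ler_pM2l.
  have := cobb_douglas_ge0 lam x0.
  rewrite /F in Fxku *; lra.
have He i : exists r, H (b i) r.
  have [u [u0 Au]] := feasible [set i]%SET.
  exists (F u), u, 0; split=> //; last by rewrite mul0r subr0.
  by rewrite Au scale0r addr0 /coalition_bundle big_set1.
(* Produce b(N \ {i}), with t = 1. *)
have HNe i : exists r, H (- b i) r.
  have [u [u0 Au]] := feasible [set~ i]%SET.
  exists (F u - nu0), u, 1; split=> //; last by rewrite mul1r.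
  rewrite Au scale1r /w0 /coalition_bundle sumT [in RHS](bigD1 i)//= addKr.
  by apply: eq_bigl => j; rewrite !inE.
have [z Hz] := cone_supporting_vector HD HZ H0 He HNe.
have zS (S : {set N}) (x : 'cV[R]_d) :
    (forall j, 0 <= x j 0) -> A x = coalition_bundle b S ->
    F x <= \sum_(i in S) z i.
  move=> x_ge0 Ax.
  have -> : \sum_(i in S) z i = \sum_i (i \in S)%:R * z i.
    by rewrite big_mkcond/=; apply: eq_bigr => i _; rewrite mulr_natl mulrb.
  apply: (Hz (fun i => (i \in S)%:R)); exists x, 0; split=> //.
  - rewrite scale0r addr0 Ax /coalition_bundle big_mkcond/=.
    by apply: eq_bigr => i _; rewrite scaler_nat mulrb.
  - by rewrite mul0r subr0.
have nu_le (S : {set N}) : nu S <= \sum_(i in S) z i.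
  rewrite -lee_fin (game S); apply: ge_ereal_sup => _ [x [x_ge0 Ax] <-].
  by rewrite lee_fin; exact: zS.
exists z; split=> [|S _]; last exact: nu_le.
apply/eqP; rewrite eq_le; apply/andP; split; last first.
  by have := nu_le [set: N]%SET; rewrite sumT.
(* Efficiency: (- b(N), - nu(N)) is in the cone, by u = 0 and t = 1. *)
rewrite -lerN2 -sumrN.
under eq_bigr do rewrite -mulN1r.
apply: (Hz (fun=> -1)); exists 0, 1; split=> //.
- by move=> j; rewrite mxE.
- rewrite linear0 scale1r -scaler_sumr scaleN1r /w0 /coalition_bundle sumT.
  by rewrite addNr.
- by rewrite mul1r lerDr cobb_douglas_ge0.
Qed.
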